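(* Let $k\ge2$ and let $I=\{0=i_0<i_1<\dots<i_k\}$ be integers with $\gcd(i_1,\dots,i_k)=1$. For $j=0,\dots,k$ let $S_j$ be the Schur polynomial in $x_1,\dots,x_k$ associated with the sequence $I\setminus\{i_j\}$; thus, in partition notation, $S_k=s_{i_{k-1}-k+1,\,i_{k-2}-k+2,\dots,\,i_1-1}$ and $S_0=s_{i_k-(k-1),\,i_{k-1}-(k-2),\dots,\,i_1}$. Then for every $s=0,1,\dots,k-1$, $$h_{i_k-s}S_k-h_{i_{k-1}-s}S_{k-1}+\dots+(-1)^{k-1}h_{i_1-s}S_1+(-1)^kh_{-s}S_0=0 .$$
   Context: For a sequence $J=(0\le j_1<\dots<j_k)$ of integers, the associated Schur polynomial is $S_J(x_1,\dots,x_k)=\det\big(x_b^{j_a}\big)_{1\le a,b\le k}/W(x_1,\dots,x_k)$, where $W(x_1,\dots,x_k)=\det\big(x_b^{a-1}\big)_{1\le a,b\le k}$; in partition notation it is $s_{j_k-(k-1),\,j_{k-1}-(k-2),\dots,\,j_1}$. Here $h_i$ is the complete symmetric polynomial of degree $i$ in $x_1,\dots,x_k$, with $h_0=1$ and $h_i=0$ for $i<0$. *)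

(* Defs.v *)
From mathcomp Require Import all_boot all_order all_algebra.
From mathcomp Require Import mpoly.

Set Implicit Arguments.
Unset Strict Implicit.
Unset Printing Implicit Defensive.

Import GRing.Theory Pdiv.CommonRing Pdiv.RingMonic.
Local Open Scope ring_scope.

(* Reduce the powers 'X^j modulo the monic polynomial \prod_b ('X - u_b). *)
Lemma exp_reduce (A : comNzRingType) (k : nat) (u : 'I_k -> A) :
  exists r : nat -> 'I_k -> A,
    forall j b, u b ^+ j = \sum_(c < k) r j c * u b ^+ c.
Proof.
pose P : {poly A} := \prod_(b < k) ('X - (u b)%:P).
have Pmon : P \is monic by exact: monic_prod_XsubC.
have szP : size P = k.+1.
  by rewrite /P size_prod_XsubC [index_enum _]unlock -enumT size_enum_ord.
exists (fun j c => (rmodp 'X^j P)`_c) => j b.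
have szr : (size (rmodp 'X^j P) <= k)%N.
  by rewrite -ltnS -szP ltn_rmodp monic_neq0.
have P0 : P.[u b] = 0.
  by rewrite horner_prod (bigD1 b) //= hornerXsubC subrr mul0r.
rewrite -[LHS]hornerXn [in LHS](rdivp_eq Pmon 'X^j).
by rewrite hornerD hornerM P0 mulr0 add0r (horner_coef_wide _ szr).
Qed.

Section SchurPolynomials.
Variables (R : idomainType) (k : nat).

(* Indices are 0-based: row a, column b holds x_b ^ (J a). *)
Definition alternant (J : 'I_k -> nat) : {mpoly R[k]} :=
  \det (\matrix_(a < k, b < k) ('X_b : {mpoly R[k]}) ^+ J a).

Definition vdet : {mpoly R[k]} :=
  \det (Vandermonde k (\row_(b < k) ('X_b : {mpoly R[k]}))).

Lemma vdet_dvd_alternant (J : 'I_k -> nat) :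
  exists S : {mpoly R[k]}, S * vdet == alternant J.
Proof.
pose x (b : 'I_k) : {mpoly R[k]} := 'X_b.
have [r Er] := exp_reduce x.
exists (\det (\matrix_(a < k, c < k) r (J a) c)).
rewrite /vdet -det_mulmx; apply/eqP; congr (\det _).
apply/matrixP => a b; rewrite !mxE -[RHS]/(x b ^+ J a) Er.
by apply: eq_bigr => c _; rewrite !mxE.
Qed.

(* The polynomial det (x_b ^ J_a) / W(x), W being vdet: see schurE for uniqueness
   and schur_frac for the quotient in the fraction field. *)
Definition schur (J : 'I_k -> nat) : {mpoly R[k]} :=
  xchoose (vdet_dvd_alternant J).

Lemma schurP (J : 'I_k -> nat) : schur J * vdet = alternant J.
Proof. exact/eqP/(xchooseP (vdet_dvd_alternant J)). Qed.

Lemma vdet_neq0 : vdet != 0.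
Proof.
rewrite /vdet det_Vandermonde; apply/prodf_neq0 => i _.
apply/prodf_neq0 => j ltij; rewrite !mxE subr_eq0.
apply/eqP => /(congr1 (mcoeff U_(j))); rewrite !mcoeffX eqxx.
have -> : (U_(i) == U_(j) :> 'X_{1..k})%MM = false.
  apply/eqP => /mnmP /(_ j); rewrite !mnm1E eqxx.
  by case: eqP ltij => // ->; rewrite ltnn.
by move/eqP; rewrite oner_eq0.
Qed.

Lemma schurE (J : 'I_k -> nat) (S : {mpoly R[k]}) :
  S * vdet = alternant J -> S = schur J.
Proof. by rewrite -schurP => /(mulIf vdet_neq0). Qed.

Lemma schur_frac (J : 'I_k -> nat) :
  tofrac (schur J) = tofrac (alternant J) / tofrac vdet.
Proof. by rewrite -schurP tofracM mulfK // tofrac_eq0 vdet_neq0. Qed.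

(* 'X_{1..k < d.+1} is the type of monomials of degree at most d. *)
Definition hsym (m : int) : {mpoly R[k]} :=
  if m is Posz d then
    \sum_(mu : 'X_{1..k < d.+1} | mdeg mu == d) 'X_[mu]
  else 0.

Lemma hsym0 : hsym 0 = 1.
Proof.
have lt01 : (mdeg (0%MM : 'X_{1..k}) < 1)%N by rewrite mdeg0.
rewrite -[hsym 0]/(hsym (Posz 0)) /hsym (bigD1 (BMultinom lt01)) /= ?mdeg0 //= mpolyX0 big1 ?addr0 //.
by move=> mu /andP[]; rewrite mdeg_eq0 => /eqP mu0 /eqP[]; apply: val_inj.
Qed.

End SchurPolynomials.

Arguments hsym R k m : clear implicits.

(* Main.v *)
Require Import Defs.
From mathcomp Require Import all_boot all_order all_algebra.
From mathcomp Require Import mpoly.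
From mathcomp Require Import zify ring.

Set Implicit Arguments.
Unset Strict Implicit.

Import GRing.Theory Pdiv.CommonRing Pdiv.RingMonic.
Local Open Scope ring_scope.

(** Let [P = \prod_b ('X - x_b)]. The sequence [n |-> h_(n-s)] with [s < k]
    satisfies the linear recurrence with characteristic polynomial [P] (each
    factor ['X - x_b] of [P] removes the variable [x_b] from [h], and positive
    degree parts in no variables vanish; [s < k] makes these degrees positive
    from [n = 0] on), so the functional ['X^n |-> h_(n-s)] on polynomials vanishes on the ideal [(P)].
    With [r j c] the coefficients of ['X^j] modulo [P], we thus have
    [h_(n-s) = \sum_c r n c * h_(c-s)], while [S_j] is the minor of the
    [(k+1) x k] matrix [r (i a) c] omitting row [j]. The alternating sum is
    therefore a combination of Laplace expansions of determinants with two equal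
    columns. *)

Section RecurrentSequences.
Variable A : comNzRingType.
Implicit Types (f g : nat -> A) (p q : {poly A}).

(** The linear functional with value [f n] at ['X^n]; for [f] the powers of [a] it is evaluation at
    [a]. *)
Definition poly_apply f p : A := \sum_(r < size p) p`_r * f r.

Lemma poly_apply_wide f p N : (size p <= N)%N ->
  poly_apply f p = \sum_(r < N) p`_r * f r.
Proof.
move=> le_pN; rewrite /poly_apply (big_ord_widen _ (fun r => p`_r * f r) le_pN).
rewrite big_mkcond; apply: eq_bigr => r _.
by case: ltnP => // le_pr; rewrite nth_default ?mul0r.
Qed.

Lemma poly_applyD f p q :
  poly_apply f (p + q) = poly_apply f p + poly_apply f q.
Proof.
pose N := maxn (size p) (size q).
rewrite !(@poly_apply_wide _ _ N) ?leq_maxl ?leq_maxr ?size_polyD // -big_split.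
by apply: eq_bigr => r _ /=; rewrite coefD mulrDl.
Qed.

Lemma poly_applyXn f n : poly_apply f 'X^n = f n.
Proof.
rewrite (@poly_apply_wide _ _ n.+1) ?size_polyXn // big_ord_recr /=.
rewrite coefXn eqxx mul1r big1 ?add0r // => r _.
by rewrite coefXn (ltn_eqF (ltn_ord r)) mul0r.
Qed.

Lemma eq_poly_apply f g p : f =1 g -> poly_apply f p = poly_apply g p.
Proof. by move=> eq_fg; apply: eq_bigr => r _; rewrite eq_fg. Qed.

Lemma poly_apply0 p : poly_apply (fun=> 0) p = 0.
Proof. by rewrite /poly_apply big1 // => r _; rewrite mulr0. Qed.

(** Multiplication by ['X] shifts the sequence, so linear factors of the argument can be traded one
    at a time for difference operators on [f]. *)
Lemma poly_apply_mulXsubC f a q :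
  poly_apply f (q * ('X - a%:P)) = poly_apply (fun n => f n.+1 - a * f n) q.
Proof.
have le_sz : (size (q * ('X - a%:P))%R <= (size q).+1)%N.
  by rewrite (leq_trans (size_polyMleq _ _)) // size_XsubC addn2.
rewrite (poly_apply_wide _ le_sz) /poly_apply.
under eq_bigr do rewrite mulrBr coefB coefMX coefMC mulrBl.
rewrite sumrB big_ord_recl mul0r add0r [X in _ - X]big_ord_recr /=.
rewrite [nth 0 q (size q)]nth_default // mul0r mul0r addr0 -sumrB.
by apply: eq_bigr => r _; rewrite mulrBr mulrA.
Qed.

(** The remainder of ['X^j] modulo the product gives [r j]. Since [r] is chosen before [f], the same
    coefficients serve the powers of each [u b] and the shifted complete symmetric polynomials. *)
Lemma recurrence_reduce k (u : 'I_k -> A) :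
  exists r : nat -> 'I_k -> A, forall f,
    (forall q, poly_apply f (q * \prod_(b < k) ('X - (u b)%:P)) = 0) ->
  forall j, f j = \sum_(c < k) r j c * f c.
Proof.
pose P : {poly A} := \prod_(b < k) ('X - (u b)%:P).
have Pmon : P \is monic by exact: monic_prod_XsubC.
have szP : size P = k.+1.
  by rewrite /P size_prod_XsubC [index_enum _]unlock -enumT size_enum_ord.
exists (fun j c => (rmodp 'X^j P)`_c) => f f_P j.
have szr : (size (rmodp 'X^j P) <= k)%N by rewrite -ltnS -szP ltn_rmodp monic_neq0.
rewrite -[LHS]poly_applyXn [in LHS](rdivp_eq Pmon 'X^j).
by rewrite poly_applyD f_P add0r (poly_apply_wide _ szr).
Qed.

Lemma exp_recurrent k (u : 'I_k -> A) b q :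
  poly_apply (GRing.exp (u b)) (q * \prod_(c < k) ('X - (u c)%:P)) = 0.
Proof.
rewrite /poly_apply -horner_coef hornerM horner_prod (bigD1 b) //=.
by rewrite hornerXsubC subrr mul0r mulr0.
Qed.

End RecurrentSequences.

Section CompleteSymmetric.
Variables (R : comNzRingType) (k : nat).

Definition supported_below (t : nat) (mu : 'X_{1..k}) : bool :=
  [forall b : 'I_k, (t <= b)%N ==> (mu b == 0%N)].

(** The complete symmetric polynomial in the first [t] variables, kept in the ring of all [k]
    variables so that induction on [t] stays in one ring. *)
Definition hsym_below (t : nat) (m : int) : {mpoly R[k]} :=
  if m is Posz d then
    \sum_(mu : 'X_{1..k < d.+1} | (mdeg mu == d) && supported_below t mu) 'X_[mu]
  else 0.

Lemma mcoeff_hsym_below t m nu :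
  (hsym_below t m)@_nu = (((mdeg nu)%:Z == m) && supported_below t nu)%:R.
Proof.
case: m => d; last by rewrite mcoeff0.
rewrite /hsym_below raddf_sum /= eqz_nat.
under eq_bigr do rewrite mcoeffX.
case: eqP => [deg_nu | ne_deg] /=; last first.
  by rewrite big1 // => mu /andP[/eqP deg_mu _]; case: eqP => // eq_mu;
     case: ne_deg; rewrite -eq_mu.
have lt_nu : (mdeg nu < d.+1)%N by rewrite deg_nu.
case: (boolP (supported_below t nu)) => [supp_nu | nsupp_nu].
  rewrite (bigD1 (BMultinom lt_nu)) /= ?deg_nu ?eqxx ?supp_nu // big1 ?addr0 //.
  by move=> mu /andP[_]; rewrite bmeqP /= => /negPf->.
rewrite big1 // => mu /andP[_ supp_mu].
by case: eqP => // eq_mu; rewrite -eq_mu supp_mu in nsupp_nu.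
Qed.

Lemma mcoeff_mulX0 (p : {mpoly R[k]}) (b : 'I_k) (nu : 'X_{1..k}) :
  nu b = 0%N -> (p * 'X_b)@_nu = 0.
Proof.
move=> nub0; rewrite mcoeffM big1 // => -[m1 m2] /eqP/mnmP/(_ b) eq_nu /=.
rewrite mcoeffX; case: eqP => [eq_m2 | _]; last by rewrite mulr0.
by move: eq_nu; rewrite nub0 mnmDE /= -eq_m2 mnm1E eqxx addn1.
Qed.

Lemma hsym_belowS (b : 'I_k) (m : int) :
  hsym_below b.+1 m = hsym_below b m + hsym_below b.+1 (m - 1) * 'X_b.
Proof.
apply/mpolyP => nu; rewrite mcoeffD.
(* A monomial free of ['X_b] occurs only in the first summand, one divisible by ['X_b] only in the
   second. *)
have [nub0 | nub_gt0] := posnP (nu b).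
  rewrite mcoeff_mulX0 // addr0 !mcoeff_hsym_below; congr (_ && _)%:R.
  apply: eq_forallb => c; rewrite [(b <= c)%N]leq_eqVlt.
  by case: (nat_of_ord b =P c) => [/ord_inj<- | //]; rewrite ltnn nub0 eqxx implybT.
have le_nu : (U_(b) <= nu)%MM.
  by apply/mnm_lepP => c; rewrite mnm1E; case: eqP => // <-.
pose mu := (nu - U_(b))%MM; have def_nu : nu = (U_(b) + mu)%MM.
  by rewrite addmC submK.
rewrite [in X in _ + X]def_nu mcoeffMX !mcoeff_hsym_below.
have -> : supported_below b nu = false.
  by apply/negbTE/forallPn; exists b; rewrite leqnn -lt0n.
rewrite andbF add0r; congr (_ && _)%:R.
  by rewrite def_nu mdegD mdeg1; lia.
apply: eq_forallb => c; rewrite def_nu mnmDE mnm1E.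
by case: (b =P c) => [<- | //]; rewrite ltnn.
Qed.

Lemma hsym_below0 (m : int) : 0 < m -> hsym_below 0 m = 0.
Proof.
move=> m_gt0; apply/mpolyP => nu; rewrite mcoeff_hsym_below mcoeff0.
case: eqP => //= deg_nu; case: (boolP (supported_below _ _)) => // /forallP nu0.
have : mdeg nu = 0%N by rewrite mdegE big1 // => b _; apply/eqP/(implyP (nu0 b)).
lia.
Qed.

End CompleteSymmetric.

Section Recurrence.
Variables (R : comNzRingType) (k : nat).
Local Notation x b := ('X_b : {mpoly R[k]}).

(** Induction on [t]: each factor removes the last variable and raises the degree by one, which the
    offset [k - t] records. At [t = 0] the degree [n + k - s] is positive. *)
Lemma poly_apply_hsym_below (s t : nat) (q : {poly {mpoly R[k]}}) :
    (s < k)%N -> (t <= k)%N ->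
  poly_apply (fun n => hsym_below R k t (n%:Z + (k - t)%:Z - s%:Z))
    (q * \prod_(b < k | (b < t)%N) ('X - (x b)%:P)) = 0.
Proof.
move=> lt_sk; elim: t q => [|t IHt] q lt_tk.
  rewrite -[RHS](poly_apply0 (q * \prod_(b < k | (b < 0)%N) ('X - (x b)%:P))).
  by apply: eq_poly_apply => n; apply: hsym_below0; lia.
pose b := Ordinal lt_tk.
rewrite (bigD1 b) //= [_ * \prod_(_ | _) _]mulrC mulrA poly_apply_mulXsubC.
rewrite (eq_bigl (fun c : 'I_k => (c < t)%N)) => [|c]; last first.
  by rewrite ltnS ltn_neqAle andbC -val_eqE.
rewrite -[RHS](IHt q (ltnW lt_tk)); apply: eq_poly_apply => n.
have /= -> := hsym_belowS R b (n.+1%:Z + (k - t.+1)%:Z - s%:Z).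
have -> : n.+1%:Z + (k - t.+1)%:Z - s%:Z - 1 = n%:Z + (k - t.+1)%:Z - s%:Z by lia.
have -> : n.+1%:Z + (k - t.+1)%:Z - s%:Z = n%:Z + (k - t)%:Z - s%:Z by lia.
by rewrite mulrC addrK.
Qed.

End Recurrence.

Lemma hsym_belowE (R : idomainType) (k : nat) (m : int) :
  hsym_below R k k m = hsym R k m.
Proof.
case: m => // d; apply: eq_bigl => mu; rewrite andb_idr // => _.
by apply/forallP => b; rewrite leqNgt ltn_ord.
Qed.

Lemma hsym_recurrent (R : idomainType) (k s : nat) (q : {poly {mpoly R[k]}}) :
    (s < k)%N ->
  poly_apply (fun n => hsym R k (n%:Z - s%:Z))
    (q * \prod_(b < k) ('X - ('X_b)%:P)) = 0.
Proof.
move=> lt_sk; rewrite -[RHS](poly_apply_hsym_below q lt_sk (leqnn k)).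
rewrite [in RHS](eq_bigl xpredT) => [|b]; last exact: ltn_ord.
by apply: eq_poly_apply => n; rewrite hsym_belowE subnn addr0.
Qed.

(** Reducing the exponents factors the alternant matrix as the matrix of [r] times the Vandermonde
    matrix. *)
Lemma schur_det (R : idomainType) (k : nat) (r : nat -> 'I_k -> {mpoly R[k]})
    (J : 'I_k -> nat) :
  (forall j b, ('X_b : {mpoly R[k]}) ^+ j = \sum_(c < k) r j c * 'X_b ^+ c) ->
  schur R J = \det (\matrix_(a < k, c < k) r (J a) c).
Proof.
move=> Er; apply/esym/schurE; rewrite /vdet -det_mulmx; congr (\det _).
apply/matrixP => a b; rewrite !mxE Er.
by apply: eq_bigr => c _; rewrite !mxE.
Qed.

Lemma sum_col_minors (A : comNzRingType) (k : nat) (N : 'M[A]_(k.+1, k)) (c : 'I_k) :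
  \sum_(j < k.+1) (-1) ^+ j * N j c * \det (row' j N) = 0.
Proof.
(* [M] is [N] with a copy of column [c] put in front: [unlift] fails only at [ord0], where the
   default [c] is taken. *)
pose M : 'M[A]_k.+1 := \matrix_(j, l) N j (odflt c (unlift ord0 l)).
have M0 j : M j ord0 = N j c by rewrite mxE unlift_none.
have Ml j a : M j (lift ord0 a) = N j a by rewrite mxE liftK.
have detM : \det M = 0.
  rewrite -det_tr (determinant_alternate (neq_lift ord0 c)) // => j.
  by rewrite [LHS]mxE [RHS]mxE M0 Ml.
rewrite -[RHS]detM (expand_det_col M ord0); apply: eq_bigr => j _.
rewrite M0 /cofactor addn0 mulrCA mulrA; congr (_ * \det _).
by apply/matrixP => a b; rewrite [LHS]mxE [RHS]mxE [RHS]mxE Ml.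
Qed.

Theorem theorem10 (R : idomainType) (k : nat) (i : 'I_k.+1 -> nat)
  (hk : (2 <= k)%N)
  (i0 : i ord0 = 0%N)
  (i_incr : forall a b : 'I_k.+1, (a < b)%N -> (i a < i b)%N)
  (i_gcd : \big[gcdn/0%N]_(a < k) i (lift ord0 a) = 1%N)
  (s : nat) (hs : (s < k)%N) :
  \sum_(j < k.+1)
     (-1) ^+ (k - j) * hsym R k ((i j)%:Z - s%:Z)
       * schur R (fun a : 'I_k => i (lift j a)) = 0.
Proof.
have [r r_rec] := recurrence_reduce (fun b : 'I_k => 'X_b : {mpoly R[k]}).
have r_exp j b := r_rec _ (exp_recurrent _ b) j.
have r_hsym j := r_rec _ (fun q => hsym_recurrent q hs) j.
pose N : 'M_(k.+1, k) := \matrix_(j, c) r (i j) c.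
have schurN (j : 'I_k.+1) : schur R (fun a : 'I_k => i (lift j a)) = \det (row' j N).
  by rewrite (schur_det _ r_exp); congr (\det _); apply/matrixP => a c; rewrite !mxE.
under eq_bigr => j _ do rewrite schurN r_hsym -mulrA mulr_suml mulr_sumr.
rewrite exchange_big big1 //= => c _.
(* For fixed [c] this common factor leaves the expansion in [sum_col_minors], as [(-1) ^+ (k - j)]
   is [(-1) ^+ k * (-1) ^+ j] for [j <= k]. *)
rewrite -[RHS](mulr0 ((-1) ^+ k * hsym R k (c%:Z - s%:Z))).
rewrite -[X in _ = _ * X](sum_col_minors N c).
rewrite mulr_sumr; apply: eq_bigr => j _.
rewrite -signr_odd oddB -1?ltnS // signr_addb !signr_odd !mxE; ring.
Qed.
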